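(* Let $\mathcal{H}$ and $\mathcal{G}$ be real Hilbert spaces, let $(L_n)_{n\in\mathbb{N}}$ and $L$ be bounded linear operators from $\mathcal{H}$ to $\mathcal{G}$, let $(B_n)_{n\in\mathbb{N}}$ and $B$ be maximally monotone operators from $\mathcal{G}$ to $2^{\mathcal{G}}$, and let $(\gamma_n)_{n\in\mathbb{N}}$ and $\gamma$ be in $(0,+\infty)$. Suppose that $L_n\to L$ in operator norm, that $(B_n)_{n\in\mathbb{N}}$ graph-converges to $B$, that $\gamma_n\to\gamma$, and that $\|L_n\|\leq 1$ for every $n\in\mathbb{N}$. Then the following hold: (i) $(L_n\overset{\gamma_n}{\diamond}B_n)_{n\in\mathbb{N}}$ graph-converges to $L\overset{\gamma}{\diamond}B$. (ii) $(L_n\overset{\gamma_n}{\bullet}B_n)_{n\in\mathbb{N}}$ graph-converges to $L\overset{\gamma}{\bullet}B$.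
   Context: A set-valued operator $A\colon\mathcal{H}\to2^{\mathcal{H}}$ has graph $\operatorname{gra}A=\{(x,x^* )\mid x^*\in Ax\}$; it is maximally monotone if it is monotone ($\langle x_1-x_2\mid x_1^*-x_2^*\rangle\geq 0$ for all $(x_1,x_1^* ),(x_2,x_2^* )\in\operatorname{gra}A$) and its graph is not properly contained in the graph of another monotone operator. $A^{-1}$ is defined by $x\in A^{-1}x^*\Leftrightarrow x^*\in Ax$. Sums, scalar multiples and compositions are pointwise, e.g. $(L^*\circ C\circ L)x=\{L^*y\mid y\in C(Lx)\}$. For a bounded linear $L\colon\mathcal{H}\to\mathcal{G}$ with adjoint $L^*$ and $C\colon\mathcal{G}\to2^{\mathcal{G}}$, the parallel composition is $L^*\triangleright C=(L^*\circ C^{-1}\circ L)^{-1}\colon\mathcal{H}\to2^{\mathcal{H}}$. For $\gamma>0$, the resolvent composition is $L\overset{\gamma}{\diamond}C=L^*\triangleright(C+\gamma^{-1}\mathrm{Id}_{\mathcal{G}})-\gamma^{-1}\mathrm{Id}_{\mathcal{H}}\colon\mathcal{H}\to2^{\mathcal{H}}$, and the resolvent cocomposition is $L\overset{\gamma}{\bullet}C=(L\overset{1/\gamma}{\diamond}C^{-1})^{-1}\colon\mathcal{H}\to2^{\mathcal{H}}$. Graph-convergence: for a sequence $(C_n)_{n\in\mathbb{N}}$ of subsets of a Hilbert space, the lower limit is the set of $x$ for which there exist $x_n\in C_n$ (for all $n\in\mathbb{N}$) with $x_n\to x$ (strongly); the upper limit is the set of $x$ for which there exist a strictly increasing sequence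 $(k_n)_{n\in\mathbb{N}}$ in $\mathbb{N}$ and points $x_n\in C_{k_n}$ with $x_n\to x$. The sequence converges in the Painlevé–Kuratowski sense if the two coincide, the common set being its limit. Operators $(A_n)_{n\in\mathbb{N}}$ graph-converge to $A$ if $(\operatorname{gra}A_n)_{n\in\mathbb{N}}$ converges to $\operatorname{gra}A$ in this sense in $\mathcal{H}\times\mathcal{H}$. *)

(* Defs.v *)
From HB Require Import structures.
From mathcomp Require Import all_boot all_order all_algebra.
From mathcomp Require Import all_classical all_reals all_analysis.

Set Implicit Arguments.
Unset Strict Implicit.
Unset Printing Implicit Defensive.

Import Order.TTheory GRing.Theory Num.Theory.
Import numFieldNormedType.Exports.

Local Open Scope classical_set_scope.
Local Open Scope ring_scope.

(* Real Hilbert spaces: complete normed modules whose norm is induced by a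
   symmetric positive definite bilinear form. *)
HB.mixin Record NormedModule_isHilbert (R : realType) (V : Type)
    of CompleteNormedModule R V := {
  inner : {dot V for (@idfun R)};
  inner_normE : forall x : V, inner x x = `|x| ^+ 2
}.

#[short(type="hilbertType")]
HB.structure Definition Hilbert (R : realType) :=
  {V of CompleteNormedModule R V & NormedModule_isHilbert R V}.

Section LinearOperators.
Context {R : realType}.

(* For an unbounded f the supremum defaults to 0, hence this is meaningful only
   for bounded linear operators. *)
Definition opnorm (V W : normedModType R) (f : V -> W) : R :=
  sup [set `|f x| | x in [set x : V | `|x| <= 1]].

(* By the Riesz representation theorem, when L is linear and bounded the set
   below is a singleton for every y; the default value 0 is then irrelevant. *)
Definition adjoint (H G : hilbertType R) (L : H -> G) (y : G) : H :=
  xget 0 [set z : H | forall x : H, inner (L x) y = inner x z].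

End LinearOperators.

Section SetValuedOperators.
Context {R : realType}.

Definition gra (T U : Type) (A : T -> set U) : set (T * U) :=
  [set z | A z.1 z.2].

Definition op_inv (T U : Type) (A : T -> set U) : U -> set T :=
  fun u => [set x | A x u].

Definition op_add (T : Type) (V : zmodType) (A B : T -> set V) : T -> set V :=
  fun x => [set a + b | a in A x & b in B x].

Definition op_sub (T : Type) (V : zmodType) (A B : T -> set V) : T -> set V :=
  fun x => [set a - b | a in A x & b in B x].

Definition op_scale_id (V : lmodType R) (c : R) : V -> set V :=
  fun x => [set c *: x].

Definition monotone (H : hilbertType R) (A : H -> set H) : Prop :=
  forall z1 z2 : H * H, gra A z1 -> gra A z2 ->
    0 <= inner (z1.1 - z2.1) (z1.2 - z2.2).

Definition maximally_monotone (H : hilbertType R) (A : H -> set H) : Prop :=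
  monotone A /\
  ~ exists A' : H -> set H, monotone A' /\ gra A `<` gra A'.

Definition adjoint_conj (H G : hilbertType R) (L : H -> G) (C : G -> set G) :
    H -> set H :=
  fun x => [set adjoint L y | y in C (L x)].

(* L^* |> C *)
Definition parallel_composition (H G : hilbertType R) (L : H -> G)
    (C : G -> set G) : H -> set H :=
  op_inv (adjoint_conj L (op_inv C)).

Definition resolvent_composition (H G : hilbertType R) (L : H -> G)
    (gamma : R) (C : G -> set G) : H -> set H :=
  op_sub (parallel_composition L (op_add C (op_scale_id gamma^-1)))
         (op_scale_id gamma^-1).

Definition resolvent_cocomposition (H G : hilbertType R) (L : H -> G)
    (gamma : R) (C : G -> set G) : H -> set H :=
  op_inv (resolvent_composition L gamma^-1 (op_inv C)).

End SetValuedOperators.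

Section PainleveKuratowski.

Definition lower_limit (T : topologicalType) (C : nat -> set T) : set T :=
  [set x | exists u : nat -> T, (forall n, C n (u n)) /\ u @ \oo --> x].

Definition upper_limit (T : topologicalType) (C : nat -> set T) : set T :=
  [set x | exists k : nat -> nat, {homo k : m n / (m < n)%N} /\
     exists u : nat -> T, (forall n, C (k n) (u n)) /\ u @ \oo --> x].

Definition PK_converges (T : topologicalType) (C : nat -> set T) (D : set T) :
    Prop :=
  lower_limit C = D /\ upper_limit C = D.

Definition graph_converges (R : realType) (H : hilbertType R)
    (A_ : nat -> H -> set H) (A : H -> set H) : Prop :=
  PK_converges (fun n => gra (A_ n)) (gra A).

End PainleveKuratowski.

(* Main.v *)
(* A pair (x, x') lies in the graph of L <>_g B iff x = L^* y for the resolvent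
   value y determined by L u - y / g \in B y with u = x' + x / g. Hence both
   limits reduce to the convergence of these resolvent values, for which
   monotonicity gives, with (z_n, z'_n) \in gra B_n tending to a point (y, y')
   of gra B,
     |y_n - z_n| <= g_n |L_n u_n - z_n / g_n - z'_n| -> g |L u - y / g - y'| = 0.
   That y and y_n exist is Minty's theorem; it and the Riesz representation
   behind the adjoint come from one minimization principle for strongly convex
   functions. The cocomposition is the case of the inverses with 1 / g. *)
Require Import Defs.
From HB Require Import structures.
From mathcomp Require Import all_boot all_order all_algebra.
From mathcomp Require Import ring lra.
From mathcomp Require Import all_classical all_reals all_analysis.

Import Order.TTheory GRing.Theory Num.Theory.
Import numFieldNormedType.Exports.

Local Open Scope classical_set_scope.
Local Open Scope ring_scope.

(** * Bilinear calculus and the Cauchy-Schwarz inequality *)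

Section InnerProduct.
Context {R : realType} {V : hilbertType R}.
Implicit Types (x y z : V) (a : R).

Lemma innerC x y : inner x y = inner y x.
Proof. by rewrite (hermC (inner : {symmetric V})) expr0 mul1r. Qed.

Lemma innerDl x y z : inner (x + y) z = inner x z + inner y z.
Proof. exact: linearDl. Qed.

Lemma innerBl x y z : inner (x - y) z = inner x z - inner y z.
Proof. exact: linearBl. Qed.

Lemma innerNl x y : inner (- x) y = - inner x y.
Proof. exact: linearNl. Qed.

Lemma innerZl a x y : inner (a *: x) y = a * inner x y.
Proof. exact: linearZl_LR. Qed.

Lemma innerDr x y z : inner x (y + z) = inner x y + inner x z.
Proof. exact: linearDr. Qed.

Lemma innerBr x y z : inner x (y - z) = inner x y - inner x z.
Proof. exact: linearBr. Qed.

Lemma innerNr x y : inner x (- y) = - inner x y.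
Proof. exact: linearNr. Qed.

Lemma innerZr a x y : inner x (a *: y) = a * inner x y.
Proof. by rewrite innerC innerZl innerC. Qed.

Definition innerE := (innerDl, innerDr, innerBl, innerBr, innerNl, innerNr,
  innerZl, innerZr).

Lemma inner_ge0 x : 0 <= inner x x.
Proof. by rewrite inner_normE sqr_ge0. Qed.

(** Follows from expanding the squared norm of [inner y y *: x - inner x y *: y], a multiple of the
    component of [x] orthogonal to [y]. *)
Lemma inner_le_norm x y : `|inner x y| <= `|x| * `|y|.
Proof.
have [->|y0] := eqVneq y 0.
  by rewrite -(scale0r 0) innerZr !mul0r scale0r !normr0 mulr0.
have ny : 0 < inner y y by rewrite inner_normE exprn_gt0 ?normr_gt0.
rewrite -(@ler_pXn2r _ 2) ?nnegrE ?mulr_ge0// exprMn -!inner_normE real_normK ?num_real//.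
have := inner_ge0 (inner y y *: x - inner x y *: y).
rewrite !innerE (innerC y x).
set a := inner x x; set b := inner y y; set c := inner x y => h.
have : 0 <= b * (a * b - c ^+ 2) by move: h; congr (_ <= _); ring.
by rewrite pmulr_rge0// subr_ge0.
Qed.

End InnerProduct.

(** * Convergence criteria and continuity of the inner product *)

Section Limits.
Context {R : realType}.

Lemma cvg_dist_le (V : normedModType R) (f : nat -> V) (l : V) (e : nat -> R) :
  (forall n, `|f n - l| <= e n) -> e @ \oo --> (0 : R) -> f @ \oo --> l.
Proof.
move=> fe e0; apply/cvgrPdistC_le => eps eps0.
near=> n; have : `|0 - e n| <= eps by near: n; exact: cvgr_dist_le e0 _ eps0.
rewrite sub0r normrN; apply: (le_trans (le_trans (fe n) (ler_norm _))).
Unshelve. all: by end_near.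
Qed.

(** A Cauchy criterion shaped for minimizing sequences, where [e n] measures how far the [n]-th
    value exceeds the infimum. *)
Lemma cvg_sqr_dist_le (V : completeNormedModType R) (f : nat -> V)
    (e : nat -> R) :
  (forall m n, `|f m - f n| ^+ 2 <= e m + e n) -> e @ \oo --> (0 : R) ->
  cvg (f @ \oo).
Proof.
move=> fe e0; apply/cauchy_cvgP/cauchy_exP => eps eps0.
have eps2 : 0 < eps ^+ 2 / 2 by rewrite divr_gt0// exprn_gt0.
have ne : \forall n \near \oo, `|0 - e n| < eps ^+ 2 / 2.
  exact: cvgr_dist_lt e0 _ eps2.
have [m em] := filter_ex ne.
exists (f m).
suff : \forall n \near \oo, ball (f m) eps (f n) by [].
apply: filterS ne => n en.
rewrite -ball_normE/= -(@ltr_pXn2r _ 2) ?nnegrE ?(ltW eps0)//.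
apply: (le_lt_trans (fe m n)); move: em en; rewrite !sub0r !normrN.
move: (ler_norm (e m)) (ler_norm (e n)); set E := eps ^+ 2; lra.
Qed.

Lemma cvg_inner (V : hilbertType R) (f g : nat -> V) (a b : V) :
  f @ \oo --> a -> g @ \oo --> b ->
  (fun n => inner (f n) (g n)) @ \oo --> inner a b.
Proof.
move=> fa gb.
apply: (@cvg_dist_le _ _ _ (fun n => `|f n - a| * `|g n| + `|a| * `|g n - b|)).
  move=> n; rewrite (_ : inner _ _ - _ = inner (f n - a) (g n) + inner a (g n - b)).
    apply: (le_trans (ler_normD _ _)); apply: lerD; exact: inner_le_norm.
  by rewrite !innerE; ring.
have -> : (0 : R) = `|a - a| * `|b| + `|a| * `|b - b|.
  by rewrite !subrr !normr0 mul0r mulr0 addr0.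
apply: cvgD; apply: cvgM => //; try exact: cvg_cst;
  apply: cvg_norm => //; apply: cvgB => //; exact: cvg_cst.
Qed.

End Limits.

(** * Minimizers of strongly convex functions *)

Section Minimization.
Context {R : realType} {U V : hilbertType R}.

(* E is the epigraph of a convex lower semicontinuous function F; the
   conclusion is F(z) >= F(z0) - <z - z0, z0> at the minimizer z0 = (x0, u0) of
   F + |.|^2 / 2. *)
Lemma strongly_convex_argmin (E : U -> V -> R -> Prop) (m0 : R) :
  (exists x u t, E x u t) ->
  (forall x u t, E x u t -> m0 <= t + (inner x x + inner u u) / 2) ->
  (forall x u t x' u' t' a, 0 <= a -> a <= 1 -> E x u t -> E x' u' t' ->
    E (x + a *: (x' - x)) (u + a *: (u' - u)) (t + a * (t' - t))) ->
  (forall (x_ : nat -> U) (u_ : nat -> V) (t_ : nat -> R) x u t,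
    x_ @ \oo --> x -> u_ @ \oo --> u -> t_ @ \oo --> t ->
    (forall n, E (x_ n) (u_ n) (t_ n)) -> E x u t) ->
  exists x0 u0 t0, E x0 u0 t0 /\ forall x u t, E x u t ->
    t0 + inner x0 x0 + inner u0 u0 <= t + inner x x0 + inner u u0.
Proof.
move=> [x1 [u1 [t1 E1]]] Elb Econv Ecl.
pose phi (x : U) (u : V) (t : R) := t + (inner x x + inner u u) / 2.
pose S := [set r | exists x u t, E x u t /\ r = phi x u t].
have Sinf : has_inf S.
  split; first by exists (phi x1 u1 t1), x1, u1, t1.
  by exists m0 => _ [x [u [t [Ext ->]]]]; exact: Elb.
pose m := inf S.
have mlb x u t : E x u t -> m <= phi x u t.
  by move=> Ext; apply: (ge_inf Sinf.2); exists x, u, t.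
have /choice[z zP] (n : nat) : exists z : U * V * R,
    E z.1.1 z.1.2 z.2 /\ phi z.1.1 z.1.2 z.2 < m + harmonic n.
  have [_ [x [u [t [Ext ->]]]] lt_m] := inf_adherent (@harmonic_gt0 R n) Sinf.
  by exists (x, u, t).
pose x_ n := (z n).1.1; pose u_ n := (z n).1.2; pose t_ n := (z n).2.
have Ez n : E (x_ n) (u_ n) (t_ n) by case: (zP n).
have phiz n : phi (x_ n) (u_ n) (t_ n) < m + harmonic n by case: (zP n).
(* m bounds the value at the midpoint, so minimizing sequences are Cauchy *)
have dist_le i j : inner (x_ i - x_ j) (x_ i - x_ j) +
    inner (u_ i - u_ j) (u_ i - u_ j) <= 4 * harmonic i + 4 * harmonic j.
  have half : 0 <= (2^-1 : R) <= 1 by lra.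
  have /mlb := Econv _ _ _ _ _ _ _ (andP half).1 (andP half).2 (Ez i) (Ez j).
  have := phiz i; have := phiz j; rewrite /phi !innerE.
  rewrite (innerC (x_ j) (x_ i)) (innerC (u_ j) (u_ i)).
  set a := inner _ _; set b := inner _ _; set c := inner _ _.
  lra.
have harm4 : (fun n => 4 * @harmonic R n) @ \oo --> (0 : R).
  by rewrite -(mulr0 4); apply: cvgM; [exact: cvg_cst | exact: cvg_harmonic].
have /cvg_ex[x0 xx0] : cvg (x_ @ \oo).
  apply: (@cvg_sqr_dist_le _ _ _ (fun n => 4 * harmonic n)) => // i j.
  apply: le_trans (dist_le i j); rewrite -inner_normE lerDl; exact: inner_ge0.
have /cvg_ex[u0 uu0] : cvg (u_ @ \oo).
  apply: (@cvg_sqr_dist_le _ _ _ (fun n => 4 * harmonic n)) => // i j.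
  apply: le_trans (dist_le i j); rewrite -inner_normE lerDr; exact: inner_ge0.
have phim : (fun n => phi (x_ n) (u_ n) (t_ n)) @ \oo --> m.
  apply: (@cvg_dist_le _ _ _ _ harmonic); last exact: cvg_harmonic.
  by move=> n; rewrite ger0_norm ?subr_ge0 ?mlb// lerBlDl ltW.
pose q := (inner x0 x0 + inner u0 u0) / 2.
(* The heights converge because the values of [phi] and their quadratic parts do. At the height
   [m - q] the limit point has [phi] equal to [m]. *)
have tt0 : t_ @ \oo --> m - q.
  rewrite [t_](_ : _ = fun n => phi (x_ n) (u_ n) (t_ n) -
      (inner (x_ n) (x_ n) + inner (u_ n) (u_ n)) / 2); last first.
    by apply/funext => n; rewrite /phi addrK.
  apply: cvgB => //; apply: cvgM; last exact: cvg_cst.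
  by apply: cvgD; apply: cvg_inner.
have E0 : E x0 u0 (m - q) by apply: Ecl xx0 uu0 tt0 Ez.
exists x0, u0, (m - q); split=> // x u t Ext.
(* On the segment from the minimizer to [(x, u, t)], [phi] at parameter [a] equals
   [m + a * (A + a * D)]. The claim is that the slope [A] at the minimizer is nonnegative. *)
pose A := t - (m - q) + inner (x - x0) x0 + inner (u - u0) u0.
pose D := (inner (x - x0) (x - x0) + inner (u - u0) (u - u0)) / 2.
have D0 : 0 <= D by rewrite divr_ge0// addr_ge0 ?inner_ge0.
suff A0 : 0 <= A by move: A0; rewrite /A !innerE; lra.
have AD a : 0 <= a -> a <= 1 -> 0 <= a * (A + a * D).
  move=> a0 a1; have /mlb := Econv _ _ _ _ _ _ a a0 a1 E0 Ext.
  rewrite -subr_ge0; congr (_ <= _); rewrite /phi /A /D /q !innerE.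
  by rewrite (innerC x0 x) (innerC u0 u); field.
rewrite leNgt; apply/negP => A0.
have dpos : 0 < D - A + 1 by lra.
(* For [A < 0] this parameter lies in (0, 1] and [A + a * D] equals [A * (1 - A) / (D - A + 1)],
   which is negative. *)
pose a := - A / (D - A + 1).
have a0 : 0 < a by rewrite divr_gt0// oppr_gt0.
have a1 : a <= 1 by rewrite ler_pdivrMr//; lra.
have := AD a (ltW a0) a1; rewrite pmulr_rge0//.
have : a * (D - A + 1) = - A by rewrite divfK// gt_eqF.
by nra.
Qed.

End Minimization.

(** * Operator norm, Riesz representation and the adjoint *)

Section BoundedOperators.
Context {R : realType}.

(** Guarantees that the [sup] in [opnorm] is a genuine supremum and not its default value. *)
Lemma opnorm_has_ubound (V W : normedModType R) (L : {linear V -> W}) :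
  bounded_near L (nbhs (0 : V)) ->
  has_ubound [set `|L x| | x in [set x : V | `|x| <= 1]].
Proof.
move=> /linear_boundedP[M [_ /(_ (M + 1))]]; rewrite ltrDl => /(_ ltr01) LM.
exists `|M + 1| => _ [y /= y1 <-]; apply: (le_trans (LM y)).
apply: (le_trans (ler_norm _)); rewrite normrM normr_id.
by rewrite -[leRHS]mulr1 ler_wpM2l.
Qed.

Lemma opnorm_ge0 (V W : normedModType R) (L : {linear V -> W}) :
  bounded_near L (nbhs (0 : V)) -> 0 <= opnorm L.
Proof.
move=> bL; apply: (ub_le_sup (opnorm_has_ubound _ _ _ bL)).
by exists (0 : V); rewrite /= ?linear0 normr0.
Qed.

Lemma opnorm_le (V W : normedModType R) (L : {linear V -> W}) :
  bounded_near L (nbhs (0 : V)) -> forall x, `|L x| <= opnorm L * `|x|.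
Proof.
move=> bL x.
have [->|x0] := eqVneq x 0; first by rewrite linear0 !normr0 mulr0.
have nx : 0 < `|x| by rewrite normr_gt0.
rewrite -ler_pdivrMr//.
have -> : `|L x| / `|x| = `|L (`|x|^-1 *: x)|.
  by rewrite linearZ normrZ ger0_norm ?invr_ge0// mulrC.
apply: (ub_le_sup (opnorm_has_ubound _ _ _ bL)).
by exists (`|x|^-1 *: x) => //=; rewrite normrZ normfV normr_id mulVf// gt_eqF.
Qed.

Lemma bounded_near_sub (V W : normedModType R) (L L' : {linear V -> W}) :
  bounded_near L (nbhs (0 : V)) -> bounded_near L' (nbhs (0 : V)) ->
  bounded_near (L \- L') (nbhs (0 : V)).
Proof.
move=> bL bL'; apply/linear_boundedP.
exists (opnorm L + opnorm L'); split; first exact: num_real.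
move=> r /ltW hr x /=; apply: (le_trans (ler_normB _ _)).
apply: (le_trans (lerD (opnorm_le _ _ L bL x) (opnorm_le _ _ L' bL' x))).
by rewrite -mulrDl ler_wpM2r.
Qed.

(** Riesz representation: the vector sought is the minimizer of [- inner (L x) y + inner x x / 2].
    The second variable [u] of the minimization principle is a dummy here. *)
Lemma adjointE (H G : hilbertType R) (L : {linear H -> G}) :
  bounded_near L (nbhs (0 : H)) ->
  forall x y, inner (L x) y = inner x (adjoint L y).
Proof.
move=> bL x y; rewrite /adjoint.
suff [z zP] : exists z, [set z : H | forall x, inner (L x) y = inner x z] z.
  by case: xgetP => [z' _ /(_ x)//|/(_ z)].
pose E (x u : H) (t : R) := - inner (L x) y <= t.
(* The lower bound is the minimum of [r ^+ 2 / 2 - opnorm L * |y| * r] over real [r], with [r]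
   standing for the norm of [x]. *)
have [] := @strongly_convex_argmin _ _ _ E (- (opnorm L * `|y|) ^+ 2 / 2).
- by exists 0, 0, 0; rewrite /E linear0 linear0l oppr0.
- move=> {}x u t; rewrite /E => /(lerD (lexx ((inner x x + inner u u) / 2))).
  rewrite addrC [leRHS]addrC; apply: le_trans.
  have := inner_ge0 u; rewrite (inner_normE x).
  have := inner_le_norm (L x) y.
  have := ler_wpM2r (normr_ge0 y) (opnorm_le _ _ L bL x).
  have := ler_norm (inner (L x) y).
  have := sqr_ge0 (`|x| - opnorm L * `|y|); nra.
- move=> {}x u t x' u' t' a a0 a1; rewrite /E => Ex Ex'.
  rewrite linearD linearZ linearB !innerE.
  have : 0 <= (1 - a) * (t + inner (L x) y) by apply: mulr_ge0; lra.
  have : 0 <= a * (t' + inner (L x') y) by apply: mulr_ge0; lra.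
  lra.
- move=> x_ u_ t_ {}x u t xx _ tt; rewrite /E => Ez.
  apply: (ler_cvg_to _ tt); last by near=> n; exact: Ez.
  apply: cvgN; apply: cvg_inner; last exact: cvg_cst.
  apply: cvg_comp xx _; exact: bounded_linear_continuous.
move=> x0 [u0 [t0 [_ min0]]]; exists x0 => {}x /=; apply/eqP; rewrite -subr_eq0.
(* A linear functional bounded below vanishes *)
set c := t0 + inner x0 x0 + inner u0 u0 in min0.
have lb a : c <= a * (inner x x0 - inner (L x) y).
  have := min0 (a *: x) 0 _ (lexx _); rewrite linear0l addr0 linearZ !innerE.
  by congr (_ <= _); ring.
apply/negPn/negP => nz.
have := lb ((c - 1) / (inner x x0 - inner (L x) y)).
rewrite divfK; last by rewrite -oppr_eq0 opprB.
lra.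
Unshelve. all: by end_near.
Qed.

(** As [adjoint] is defined by choice, additivity has to be recovered: by [adjointE] the difference
    of the two sides is orthogonal to itself. *)
Lemma adjointB (H G : hilbertType R) (L : {linear H -> G}) :
  bounded_near L (nbhs (0 : H)) ->
  forall y z, adjoint L (y - z) = adjoint L y - adjoint L z.
Proof.
move=> bL y z; apply/eqP; rewrite -subr_eq0 -normr_eq0 -sqrf_eq0 -inner_normE.
set d := _ - _; rewrite {2}/d !innerBr -!adjointE// innerBr; apply/eqP; ring.
Qed.

Lemma adjoint_subl (H G : hilbertType R) (L L' : {linear H -> G}) :
  bounded_near L (nbhs (0 : H)) -> bounded_near L' (nbhs (0 : H)) ->
  forall y, adjoint (L \- L') y = adjoint L y - adjoint L' y.
Proof.
move=> bL bL' y; apply/eqP; rewrite -subr_eq0 -normr_eq0 -sqrf_eq0 -inner_normE.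
set d := _ - _; rewrite {2}/d !innerBr -!adjointE//; last exact: bounded_near_sub.
by rewrite /= innerBl subrr.
Qed.

(** With [z = adjoint L y], the square of the norm of [z] is [inner (L z) y]; Cauchy-Schwarz
    applies, and one factor of the norm of [z] cancels. *)
Lemma norm_adjoint_le (H G : hilbertType R) (L : {linear H -> G}) :
  bounded_near L (nbhs (0 : H)) -> forall y, `|adjoint L y| <= opnorm L * `|y|.
Proof.
move=> bL y; set z := adjoint L y.
have [->|z0] := eqVneq z 0.
  by rewrite normr0 mulr_ge0// opnorm_ge0.
have nz : 0 < `|z| by rewrite normr_gt0.
rewrite -(ler_pM2r nz) -expr2 -inner_normE {2}/z -adjointE//.
apply: (le_trans (ler_norm _)); apply: (le_trans (inner_le_norm _ _)).
by rewrite mulrAC ler_wpM2r// opnorm_le.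
Qed.

End BoundedOperators.

(** * Maximal monotonicity and Minty's theorem *)

Section MaximalMonotonicity.
Context {R : realType} {H : hilbertType R}.
Implicit Types B : H -> set H.

(** A point monotonically related to the whole graph could be added to it without losing
    monotonicity. Conversely, every point of a monotone extension is related in this way to the
    original graph. *)
Lemma maximally_monotoneP B : maximally_monotone B <->
  Defs.monotone B /\
  forall x u, (forall y v, B y v -> 0 <= inner (x - y) (u - v)) -> B x u.
Proof.
split=> [[mB maxB]|[mB maxB]]; split=> //.
  move=> x u xu; apply: contrapT => nxu; apply: maxB.
  exists (fun y => B y `|` [set v | y = x /\ v = u]); split.
    move=> [y v] [y' v'] [/= Byv|/= [-> ->]] [/= Byv'|/= [-> ->]].
    - exact: (mB (y, v) (y', v')).
    - by rewrite -opprB innerNl -innerNr opprB; exact: xu.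
    - exact: xu.
    - by rewrite subrr linear0l.
  split; first by move=> [y v] /= Byv; left.
  by move=> sub; apply/nxu/(sub (x, u)); right.
move=> [A [mA [BA nAB]]]; apply: nAB => -[x u] /= Axu.
apply: maxB => y v Byv; exact: (mA (x, u) (y, v) Axu (BA (y, v) Byv)).
Qed.

Lemma maximally_monotone_inv B :
  maximally_monotone B -> maximally_monotone (op_inv B).
Proof.
move=> /maximally_monotoneP[mB maxB]; apply/maximally_monotoneP; split.
  move=> [y v] [y' v'] /= Byv Byv'; rewrite innerC.
  exact: (mB (v, y) (v', y')).
by move=> x u xu; apply: maxB => y v Byv; rewrite innerC; exact: xu.
Qed.

(* The minimized function is F(x, u) + (|x|^2 + |u|^2) / 2, with F the
   Fitzpatrick function of B, given through its epigraph; its value is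
   nonnegative because F dominates the duality product. *)
Lemma maximally_monotone_zero B :
  maximally_monotone B -> exists x, B x (- x).
Proof.
move=> /maximally_monotoneP[mB maxB].
pose E x u t := forall y v, B y v -> inner x v + inner y u - inner y v <= t.
(* If [t < inner x u], every graph point is strictly related to [(x, u)]. Maximality then puts
   [(x, u)] itself in the graph, and comparing it with itself gives [0 < 0]. *)
have dual_le x u t : E x u t -> inner x u <= t.
  move=> Ext; rewrite leNgt; apply/negP => tlt.
  have gt0 y v : B y v -> 0 < inner (x - y) (u - v).
    by move=> /Ext; rewrite !innerE; lra.
  have /gt0 : B x u by apply: maxB => y v /gt0/ltW.
  by rewrite subrr linear0l ltxx.
have [] := @strongly_convex_argmin _ _ _ E 0.
(* At a graph point, monotonicity bounds the Fitzpatrick function by the duality product; for an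
   empty graph the epigraph condition is vacuous. *)
- have [[y [v Byv]]|noB] := pselect (exists y v, B y v).
    exists y, v, (inner y v) => y' v' Byv'.
    have := mB (y, v) (y', v') Byv Byv'; rewrite /= !innerE; lra.
  by exists 0, 0, 0 => y v Byv; case: noB; exists y, v.
- move=> x u t /dual_le; have := inner_ge0 (x + u).
  rewrite !innerE (innerC u x); lra.
- move=> x u t x' u' t' a a0 a1 Ez Ez' y v Byv.
  have := Ez _ _ Byv; have := Ez' _ _ Byv; rewrite !innerE.
  set p := _ - _; set p' := inner x v + _ - _ => pt' pt.
  have : 0 <= (1 - a) * (t - p') by apply: mulr_ge0; lra.
  have : 0 <= a * (t' - p) by apply: mulr_ge0; lra.
  rewrite /p /p'; lra.
- move=> x_ u_ t_ x u t xx uu tt Ez y v Byv.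
  apply: (ler_cvg_to _ tt); last by near=> n; exact: (Ez n y v Byv).
  apply: cvgB; last exact: cvg_cst.
  by apply: cvgD; apply: cvg_inner => //; exact: cvg_cst.
move=> x0 [u0 [t0 [/dual_le t0ge min0]]].
(* Minimality tested at [(y, v, inner y v)] shows that [(- u0, - x0)] is monotonically related to
   the graph, hence belongs to it. Inserting this point in the estimate itself then forces
   [x0 + u0 = 0]. *)
have related y v : B y v ->
    inner (x0 + u0) (x0 + u0) <= inner (- u0 - y) (- x0 - v).
  move=> Byv; have : E y v (inner y v).
    move=> y' v' Byv'.
    have := mB (y, v) (y', v') Byv Byv'; rewrite /= !innerE; lra.
  move=> /min0; rewrite !innerE (innerC u0 x0) (innerC u0 v).
  set a := inner x0 u0 in t0ge *; lra.
have B0 : B (- u0) (- x0).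
  by apply: maxB => y v /related; apply: le_trans; exact: inner_ge0.
have := related _ _ B0; rewrite subrr linear0l inner_normE.
rewrite exprn_even_le0//= normr_eq0 addrC addr_eq0 => /eqP u0E.
by exists x0; move: B0; rewrite u0E opprK.
Unshelve. all: by end_near.
Qed.

(** Shifting by [w] and dividing by [c] preserves maximal monotonicity, so [maximally_monotone_zero]
    applies to the operator taking [x] to [c^-1 *: (B x - w)]. *)
Lemma minty B (c : R) (w : H) :
  0 < c -> maximally_monotone B -> exists x, B x (w - c *: x).
Proof.
move=> c0 /maximally_monotoneP[mB maxB].
have [|x Bx] := @maximally_monotone_zero (fun x => [set u | B x (w + c *: u)]).
  apply/maximally_monotoneP; split.
    move=> [y v] [y' v'] Byv Byv' /=.
    have := mB (y, w + c *: v) (y', w + c *: v') Byv Byv'.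
    by rewrite /= opprD addrACA subrr add0r -scalerBr innerZr pmulr_rge0.
  move=> x u xu; apply: maxB => y v Byv.
  have := xu y (c^-1 *: (v - w)); rewrite /= scalerA mulfV ?gt_eqF// scale1r.
  rewrite addrC subrK => /(_ Byv); rewrite -(pmulr_rge0 _ c0) -innerZr scalerBr.
  by rewrite scalerA mulfV ?gt_eqF// scale1r opprB addrCA addrA.
by exists x; rewrite -scalerN.
Qed.

End MaximalMonotonicity.

(** * Limit sets and subsequences *)

Lemma lower_limit_subset_upper_limit (T : topologicalType)
    (C : nat -> set T) : lower_limit C `<=` upper_limit C.
Proof. by move=> x [u [Cu ux]]; exists id; split=> //; exists u. Qed.

Lemma cvg_homo_ltn (k : nat -> nat) :
  {homo k : m n / (m < n)%N} -> k @ \oo --> \oo.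
Proof.
move=> kmono; have le_k n : (n <= k n)%N.
  by elim: n => // n IH; apply: leq_ltn_trans IH (kmono _ _ (ltnSn n)).
move=> A [N _ NA]; exists N => // n /= Nn; apply: NA => /=.
exact: leq_trans Nn (le_k n).
Qed.

(** * Joint continuity of operators and adjoints in operator and argument *)

Section OperatorLimits.
Context {R : realType} {H G : hilbertType R}.
Variables (L_ : nat -> {linear H -> G}) (L : {linear H -> G}).
Hypothesis bL_ : forall n, bounded_near (L_ n) (nbhs (0 : H)).
Hypothesis bL : bounded_near L (nbhs (0 : H)).
Hypothesis cvg_L : (fun n => opnorm (L_ n \- L)) @ \oo --> (0 : R).

Lemma cvg_linear (u_ : nat -> H) (u : H) :
  u_ @ \oo --> u -> (fun n => L_ n (u_ n)) @ \oo --> L u.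
Proof.
move=> uu.
apply: (@cvg_dist_le _ _ _ _
    (fun n => opnorm (L_ n \- L) * `|u_ n| + opnorm L * `|u_ n - u|)).
  move=> n; rewrite (_ : _ - _ = (L_ n \- L) (u_ n) + L (u_ n - u)).
    apply: (le_trans (ler_normD _ _)); apply: lerD; apply: opnorm_le => //.
    exact: bounded_near_sub.
  by rewrite /= linearB addrA subrK.
have -> : (0 : R) = 0 * `|u| + opnorm L * `|u - u|.
  by rewrite subrr normr0 mul0r mulr0 addr0.
apply: cvgD; apply: cvgM => //; try exact: cvg_cst;
  apply: cvg_norm => //; apply: cvgB => //; exact: cvg_cst.
Qed.

(** Convergence in operator norm passes to adjoints, because [norm_adjoint_le] bounds the adjoint of
    [L_ n \- L] by [opnorm (L_ n \- L)]. *)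
Lemma cvg_adjoint (y_ : nat -> G) (y : G) :
  y_ @ \oo --> y -> (fun n => adjoint (L_ n) (y_ n)) @ \oo --> adjoint L y.
Proof.
move=> yy.
apply: (@cvg_dist_le _ _ _ _
    (fun n => opnorm (L_ n \- L) * `|y_ n| + opnorm L * `|y_ n - y|)).
  move=> n.
  rewrite (_ : _ - _ = adjoint (L_ n \- L) (y_ n) + adjoint L (y_ n - y)).
    apply: (le_trans (ler_normD _ _)); apply: lerD; apply: norm_adjoint_le => //.
    exact: bounded_near_sub.
  by rewrite adjoint_subl// adjointB// addrA subrK.
have -> : (0 : R) = 0 * `|y| + opnorm L * `|y - y|.
  by rewrite subrr normr0 mul0r mulr0 addr0.
apply: cvgD; apply: cvgM => //; try exact: cvg_cst;
  apply: cvg_norm => //; apply: cvgB => //; exact: cvg_cst.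
Qed.

End OperatorLimits.

(** * Convergence of resolvent values *)

Section ResolventLimit.
Context {R : realType} {G : hilbertType R}.

(** Graph convergence enters as one inclusion into the lower limit, a form that passes to
    subsequences. *)
Lemma cvg_resolvent (B_ : nat -> G -> set G) (B : G -> set G)
    (c_ : nat -> R) (c : R) (w_ y_ : nat -> G) (w y : G) :
  (forall n, Defs.monotone (B_ n)) ->
  gra B `<=` lower_limit (fun n => gra (B_ n)) ->
  (forall n, 0 < c_ n) -> 0 < c -> c_ @ \oo --> c -> w_ @ \oo --> w ->
  (forall n, B_ n (y_ n) (w_ n - c_ n *: y_ n)) -> B y (w - c *: y) ->
  y_ @ \oo --> y.
Proof.
move=> mB subB c_gt0 c_pos cc ww By_ By.
have [z [Bz zy]] := subB (y, w - c *: y) By.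
have z1 : (fun n => (z n).1) @ \oo --> y by exact: cvg_comp zy cvg_fst.
have z2 : (fun n => (z n).2) @ \oo --> w - c *: y by exact: cvg_comp zy cvg_snd.
(* The residual of the approximating graph point [z n] in the resolvent equation solved by
   [y_ n]. *)
pose r n := w_ n - c_ n *: (z n).1 - (z n).2.
have r0 : r @ \oo --> (0 : G).
  rewrite -(subrr (w - c *: y)); apply: cvgB => //; apply: cvgB => //.
  exact: cvgZ.
suff yz0 : (fun n => y_ n - (z n).1) @ \oo --> (0 : G).
  rewrite [y_](_ : _ = fun n => (y_ n - (z n).1) + (z n).1); last first.
    by apply/funext => n; rewrite subrK.
  by rewrite -(add0r y); exact: cvgD.
apply: (@cvg_dist_le _ _ _ _ (fun n => (c_ n)^-1 * `|r n|)); last first.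
  rewrite -(mulr0 (c^-1)) -(normr0 G); apply: cvgM; last exact: cvg_norm.
  by apply: cvgV => //; rewrite gt_eqF.
move=> n; rewrite subr0 ler_pdivlMl//; set d := y_ n - (z n).1.
have [->|d0] := eqVneq d 0; first by rewrite normr0 mulr0.
have nd : 0 < `|d| by rewrite normr_gt0.
rewrite -(ler_pM2r nd) -mulrA -expr2 -inner_normE.
apply: (le_trans _ (inner_le_norm (r n) d)); apply: le_trans (ler_norm _).
(* The dual components differ by [r n - c_ n *: d], so monotonicity reads
   [c_ n * inner d d <= inner (r n) d]. *)
have := mB n (y_ n, _) (z n) (By_ n) (Bz n).
rewrite /= -/d (_ : _ - _ - (z n).2 = r n - c_ n *: d).
  by rewrite innerBr innerZr subr_ge0 (innerC (r n)).
rewrite /r /d scalerBr opprB -!addrA; congr (_ + _).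
by rewrite [RHS]addrCA addKr addrC.
Qed.

End ResolventLimit.

(** * Graph convergence of resolvent compositions *)

Section ResolventComposition.
Context {R : realType} {H G : hilbertType R}.

Lemma resolvent_compositionP (L : H -> G) (g : R) (C : G -> set G) (x x' : H) :
  resolvent_composition L g C x x' <->
  exists y, x = adjoint L y /\ C y (L (x' + g^-1 *: x) - g^-1 *: y).
Proof.
split.
  move=> [a [y [p Cyp [_ -> pE]] <-] [_ -> <-]].
  by exists y; rewrite subrK -pE addrK.
move=> [y [-> Cy]]; exists (x' + g^-1 *: adjoint L y).
  by exists y => //; eexists; [exact: Cy | eexists; [reflexivity|rewrite subrK]].
by eexists; [reflexivity | rewrite addrK].
Qed.

Variables (L_ : nat -> {linear H -> G}) (L : {linear H -> G}).
Variables (B_ : nat -> G -> set G) (B : G -> set G).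
Variables (g_ : nat -> R) (g : R).
Hypothesis bL_ : forall n, bounded_near (L_ n) (nbhs (0 : H)).
Hypothesis bL : bounded_near L (nbhs (0 : H)).
Hypothesis cvg_L : (fun n => opnorm (L_ n \- L)) @ \oo --> (0 : R).
Hypothesis maxB_ : forall n, maximally_monotone (B_ n).
Hypothesis maxB : maximally_monotone B.
Hypothesis subB : gra B `<=` lower_limit (fun n => gra (B_ n)).
Hypothesis g_gt0 : forall n, 0 < g_ n.
Hypothesis g_pos : 0 < g.
Hypothesis cvg_g : g_ @ \oo --> g.

Let cvg_gV : (fun n => (g_ n)^-1) @ \oo --> g^-1.
Proof. by apply: cvgV => //; rewrite gt_eqF. Qed.

Lemma graph_converges_resolvent_composition :
  graph_converges (fun n => resolvent_composition (L_ n) (g_ n) (B_ n))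
                  (resolvent_composition L g B).
Proof.
(* Since the lower limit always lies in the upper one, two inclusions close the cycle. *)
suff [lo up] : gra (resolvent_composition L g B) `<=`
      lower_limit (fun n => gra (resolvent_composition (L_ n) (g_ n) (B_ n))) /\
    upper_limit (fun n => gra (resolvent_composition (L_ n) (g_ n) (B_ n))) `<=`
      gra (resolvent_composition L g B).
  have lu := @lower_limit_subset_upper_limit _
    (fun n => gra (resolvent_composition (L_ n) (g_ n) (B_ n))).
  by split; apply/seteqP; split=> // z; [move=> /lu/up | move=> /lo/lu].
split=> [[x x'] /resolvent_compositionP[y /= [xE By]]|].
  (* The recovery sequence keeps this parameter [u] fixed and moves only the resolvent value, which
     [minty] supplies for each [n]. *)
  pose u := x' + g^-1 *: x.
  have /choice[y_ By_] n : exists y, B_ n y (L_ n u - (g_ n)^-1 *: y).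
    by apply: minty => //; rewrite invr_gt0.
  have yy : y_ @ \oo --> y.
    apply: (@cvg_resolvent _ _ B_ B _ _ (fun n => L_ n u) _
      _ _ _ subB _ _ cvg_gV _ By_ By).
    - by move=> n; case: (maxB_ n).
    - by move=> n; rewrite invr_gt0.
    - by rewrite invr_gt0.
    - by apply: cvg_linear => //; exact: cvg_cst.
  have ay : (fun n => adjoint (L_ n) (y_ n)) @ \oo --> x.
    by rewrite xE; exact: cvg_adjoint.
  have uy : (fun n => u - (g_ n)^-1 *: adjoint (L_ n) (y_ n)) @ \oo
      --> u - g^-1 *: x.
    by apply: cvgB; [exact: cvg_cst | exact: cvgZ].
  exists (fun n => (adjoint (L_ n) (y_ n), u - (g_ n)^-1 *: adjoint (L_ n) (y_ n))).
  split.
    move=> n; apply/resolvent_compositionP; exists (y_ n); split=> //.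
    by rewrite subrK.
  rewrite -(addrK (g^-1 *: x) x') -/u; exact: cvg_pair ay uy.
move=> [x x'] [k [kmono [z [Mz zx]]]].
have kk := cvg_homo_ltn _ kmono.
have z1 : (fun n => (z n).1) @ \oo --> x by exact: cvg_comp zx cvg_fst.
have z2 : (fun n => (z n).2) @ \oo --> x' by exact: cvg_comp zx cvg_snd.
have /choice[y_ By_] n : exists y, (z n).1 = adjoint (L_ (k n)) y /\
    B_ (k n) y (L_ (k n) ((z n).2 + (g_ (k n))^-1 *: (z n).1) - (g_ (k n))^-1 *: y).
  by apply/resolvent_compositionP; exact: Mz.
pose u_ n := (z n).2 + (g_ (k n))^-1 *: (z n).1.
pose u := x' + g^-1 *: x.
have cvg_gkV : (fun n => (g_ (k n))^-1) @ \oo --> g^-1 by exact: cvg_comp kk cvg_gV.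
have cvg_Lk : (fun n => opnorm (L_ (k n) \- L)) @ \oo --> (0 : R).
  exact: cvg_comp kk cvg_L.
have uu : u_ @ \oo --> u by apply: cvgD => //; exact: cvgZ.
(* The candidate [y] is obtained from the limit data alone; the values [y_] along the subsequence
   are then shown to converge to it, and uniqueness of limits identifies [x] with [adjoint L y]. *)
have [|y By] := @minty _ _ B g^-1 (L u) _ maxB; first by rewrite invr_gt0.
have yy : y_ @ \oo --> y.
  apply: (@cvg_resolvent _ _ (B_ \o k) B _ _ (fun n => L_ (k n) (u_ n)) _
    _ _ _ _ _ _ cvg_gkV _ _ By).
  - by move=> n; case: (maxB_ (k n)).
  - by move=> p /subB[v [Bv vp]]; exists (v \o k); split;
      [move=> n; exact: Bv | exact: cvg_comp kk vp].
  - by move=> n; rewrite invr_gt0.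
  - by rewrite invr_gt0.
  - by apply: (cvg_linear (L_ \o k) L _ bL cvg_Lk _ _ uu) => n /=.
  - by move=> n; case: (By_ n).
have ax : (fun n => (z n).1) @ \oo --> adjoint L y.
  rewrite (_ : (fun n => (z n).1) = fun n => adjoint (L_ (k n)) (y_ n)).
    by apply: (cvg_adjoint (L_ \o k) L _ bL cvg_Lk _ _ yy) => n /=.
  by apply/funext => n; case: (By_ n).
have xE : x = adjoint L y by exact: (cvg_unique _ z1 ax).
by apply/resolvent_compositionP; exists y.
Qed.

End ResolventComposition.

(** * Graph limits of inverse operators *)

Lemma lower_limit_gra_inv (R : realType) (H : hilbertType R)
    (A_ : nat -> H -> set H) (z : H * H) :
  lower_limit (fun n => gra (A_ n)) z ->
  lower_limit (fun n => gra (op_inv (A_ n))) (z.2, z.1).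
Proof.
move=> [u [Au uz]]; exists (fun n => ((u n).2, (u n).1)); split=> //.
exact: cvg_pair (cvg_comp _ _ uz cvg_snd) (cvg_comp _ _ uz cvg_fst).
Qed.

Lemma upper_limit_gra_inv (R : realType) (H : hilbertType R)
    (A_ : nat -> H -> set H) (z : H * H) :
  upper_limit (fun n => gra (A_ n)) z ->
  upper_limit (fun n => gra (op_inv (A_ n))) (z.2, z.1).
Proof.
move=> [k [kmono [u [Au uz]]]]; exists k; split=> //.
exists (fun n => ((u n).2, (u n).1)); split=> //.
exact: cvg_pair (cvg_comp _ _ uz cvg_snd) (cvg_comp _ _ uz cvg_fst).
Qed.

Lemma graph_converges_inv (R : realType) (H : hilbertType R)
    (A_ : nat -> H -> set H) (A : H -> set H) :
  graph_converges A_ A -> graph_converges (fun n => op_inv (A_ n)) (op_inv A).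
Proof.
move=> [loA upA]; split; apply/seteqP; split=> -[x x'].
- move=> /lower_limit_gra_inv/=.
  (* The previous lemma produces a double [op_inv], which is convertible to the original
     operator. *)
  by rewrite -/(lower_limit (fun n => gra (A_ n)) (x', x)) loA.
- move=> Az; apply: (@lower_limit_gra_inv _ _ A_ (x', x)); by rewrite loA.
- move=> /upper_limit_gra_inv/=.
  by rewrite -/(upper_limit (fun n => gra (A_ n)) (x', x)) upA.
- move=> Az; apply: (@upper_limit_gra_inv _ _ A_ (x', x)); by rewrite upA.
Qed.
Theorem proposition5p8 (R : realType) (H G : hilbertType R)
    (L_ : nat -> {linear H -> G}) (L : {linear H -> G})
    (B_ : nat -> G -> set G) (B : G -> set G)
    (gamma_ : nat -> R) (gamma : R)
    (bounded_L_ : forall n, bounded_near (L_ n) (nbhs (0 : H)))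
    (bounded_L : bounded_near L (nbhs (0 : H)))
    (maxmon_B_ : forall n, maximally_monotone (B_ n))
    (maxmon_B : maximally_monotone B)
    (gamma_gt0_ : forall n, 0 < gamma_ n)
    (gamma_gt0 : 0 < gamma)
    (cvg_L : (fun n => opnorm (L_ n \- L)) @ \oo --> (0 : R))
    (cvg_B : graph_converges B_ B)
    (cvg_gamma : gamma_ @ \oo --> gamma)
    (norm_L_ : forall n, opnorm (L_ n) <= 1) :
  graph_converges (fun n => resolvent_composition (L_ n) (gamma_ n) (B_ n))
                  (resolvent_composition L gamma B) /\
  graph_converges (fun n => resolvent_cocomposition (L_ n) (gamma_ n) (B_ n))
                  (resolvent_cocomposition L gamma B).
Proof.
have cvg_gammaV : (fun n => (gamma_ n)^-1) @ \oo --> gamma^-1.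
  by apply: cvgV => //; rewrite gt_eqF.
split; first by apply: graph_converges_resolvent_composition => //; rewrite cvg_B.1.
apply: graph_converges_inv; apply: graph_converges_resolvent_composition => //.
- by move=> n; exact: maximally_monotone_inv.
- exact: maximally_monotone_inv.
- by rewrite (graph_converges_inv _ _ _ _ cvg_B).1.
- by move=> n; rewrite invr_gt0.
- by rewrite invr_gt0.
Qed.
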